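(* Let $m\geq 2$ and let $K\neq\Delta_{[m]}$ be a simplicial complex on $[m]$. Then $\Sigma_K$ is a complete regular fan in $\mathbb{R}^{m-1}$, and $\mathrm{Bier}(K)$ is isomorphic to the underlying simplicial complex of $\Sigma_K$.
   Context: Simplicial complexes. $[m]=\{1,\dots,m\}$. A simplicial complex on a finite set $S$ is a non-empty family $K\subseteq 2^{S}$ closed under taking subsets (so $\varnothing\in K$); elements of $S$ need not be vertices: $i\in S$ is a (geometric) vertex if $\{i\}\in K$ and a ghost vertex otherwise. $\Delta_{[m]}=2^{[m]}$. Facets are the inclusion-maximal elements of $K$; minimal non-faces are the inclusion-minimal subsets of $S$ not in $K$. Bier spheres. Let $[m']=\{1',\dots,m'\}$ be a disjoint copy of $[m]$; for $J\subseteq[m]$ let $J'=\{j'\mid j\in J\}$. For $K\neq\Delta_{[m]}$ the Alexander dual $K^\vee$ is the simplicial complex on $[m']$ whose facets are exactly the sets $[m']\setminus I'$ with $I$ a minimal non-face of $K$. The Bier sphere is $\mathrm{Bier}(K)=\{I\sqcup J'\mid I\in K,\ J'\in K^\vee,\ I\cap J=\varnothing\}$, a simplicial complex on $[m]\sqcup[m']$. Fans. A rational polyhedral cone in $\mathbb{R}^n$ is the set $\mathbb{R}_{\ge}\langle S\rangle$ of non-negative real combinations of a finite set $S\subset\mathbb{Z}^n$; cones are assumed strongly convex (containing no line). A cone is nonsingular if it is generated by a part of a basis of $\mathbb{Z}^n$, and simplicial if it is generated by a part of a basis of $\mathbb{R}^n$. A fan in $\mathbb{R}^n$ is a (finite)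 set $\Sigma$ of such cones such that each face of a cone in $\Sigma$ is in $\Sigma$ and the intersection of any two cones in $\Sigma$ is a face of each. It is complete if the union of its cones is $\mathbb{R}^n$, simplicial (regular) if all its cones are simplicial (nonsingular). If $\Sigma$ is simplicial and $v_1,\dots,v_k$ are the primitive integer generators of its 1-dimensional cones, its underlying simplicial complex is the complex on $[k]$ in which $\{i_1,\dots,i_p\}$ is a face if and only if $v_{i_1},\dots,v_{i_p}$ generate a cone of $\Sigma$. The canonical fan. Let $e_1,\dots,e_{m-1}$ be the standard basis of $\mathbb{R}^{m-1}$ and $e_m:=-(e_1+\cdots+e_{m-1})$. For $I,J\subset[m]$ with $I\cap J=\varnothing$ let $G(I,J)=\{-e_i,\ e_j\mid i\in I,\ j\in J\}$ and $C(I,J)=\mathbb{R}_{\ge}\langle G(I,J)\rangle$. Then $\Sigma_K:=\{C(I,J)\mid I\in K,\ J'\in K^\vee,\ I\cap J=\varnothing\}$. Isomorphism convention: the isomorphism of complexes is a bijection between the sets of geometric vertices under which faces correspond to faces in both directions (ghost vertices of $\mathrm{Bier}(K)$ are disregarded). *)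

(* Defs.v *)
From mathcomp Require Import all_boot all_order all_algebra.

Set Implicit Arguments.
Unset Strict Implicit.
Unset Printing Implicit Defensive.

Import GRing.Theory Num.Theory.

Local Open Scope ring_scope.

Section Complexes.
Implicit Types T U : finType.

Definition simplicial_complex T (K : {set {set T}}) : Prop :=
  K != set0 /\ (forall A B : {set T}, A \in K -> B \subset A -> B \in K).

Definition geom_vertices T (K : {set {set T}}) : {set T} :=
  [set x | [set x] \in K].

Definition facets T (K : {set {set T}}) : {set {set T}} :=
  [set A : {set T} | maxset (mem K) A].

Definition min_nonfaces T (K : {set {set T}}) : {set {set T}} :=
  [set A : {set T} | minset [pred B | B \notin K] A].

(* The complex generated by the sets ~: I, for I a minimal non-face of K; see  *)
(* facets_alexander_dual.  The copy [m'] of the ground set is T itself here,   *)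
(* and becomes disjoint from T only in bier.                                   *)
Definition alexander_dual T (K : {set {set T}}) : {set {set T}} :=
  [set J : {set T} | [exists I in min_nonfaces K, J \subset ~: I]].

(* The ground set is T + T: inl x stands for x and inr x for its copy x'.      *)
Definition bier T (K : {set {set T}}) : {set {set (T + T)%type}} :=
  [set (inl @: I) :|: (inr @: J)
    | I : {set T} in K, J : {set T} in alexander_dual K & [disjoint I & J]].

(* Ghost vertices are disregarded: f only relates geometric vertices.          *)
Definition complex_iso T U (K : {set {set T}}) (L : {set {set U}}) : Prop :=
  exists f : {x : T | x \in geom_vertices K} -> {y : U | y \in geom_vertices L},
    bijective f /\
    forall A : {set {x : T | x \in geom_vertices K}},
      (val @: A \in K) = (val @: (f @: A) \in L).

Lemma facets_alexander_dual T (K : {set {set T}}) :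
  facets (alexander_dual K) = [set ~: I | I in min_nonfaces K].
Proof.
apply/setP => A; rewrite inE; apply/idP/imsetP.
  case/maxsetP; rewrite /= inE => /existsP[I /andP[IK AI]] maxA.
  exists I => //; apply/esym/maxA => //.
  by rewrite /= inE; apply/existsP; exists I; rewrite IK /=.
move=> [I IK ->]; apply/maxsetP; split.
  by rewrite /= inE; apply/existsP; exists I; rewrite IK /=.
move=> B; rewrite /= inE => /existsP[I' /andP[I'K BI']] IB.
have I'I : I' \subset I by rewrite -setCS (subset_trans IB).
move: IK I'K; rewrite !inE => /minsetP[_ minI] /minsetP[I'K _].
by apply/eqP; rewrite eqEsubset IB andbT -(minI _ I'K I'I).
Qed.

End Complexes.

From mathcomp Require Import finmap.
From mathcomp Require Import boolp classical_sets cardinality reals.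

Section Cones.
Variables (R : realType) (n : nat).

Implicit Types (S : {fset 'rV[int]_n}) (v w : 'rV[int]_n).
Implicit Types (C F : set 'rV[R]_n) (Sigma : set (set 'rV[R]_n)).

Definition int_vec v : 'rV[R]_n := map_mx intr v.

Definition cone S : set 'rV[R]_n :=
  [set x : 'rV[R]_n | exists c : 'rV[int]_n -> R,
     (forall v, 0 <= c v) /\ x = \sum_(v <- S) c v *: int_vec v]%classic.

Definition strongly_convex C : Prop :=
  ~ exists x y : 'rV[R]_n, y != 0 /\ forall t : R, C (x + t *: y).

Definition rational_cone C : Prop :=
  (exists S, C = cone S) /\ strongly_convex C.

Definition lattice_basis (b : 'I_n -> 'rV[int]_n) : Prop :=
  forall v, exists! a : 'rV[int]_n, v = \sum_i a 0 i *: b i.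

Definition nonsingular_cone C : Prop :=
  exists S (b : 'I_n -> 'rV[int]_n),
    [/\ lattice_basis b, (forall v, v \in S -> exists i, v = b i)
      & C = cone S].

(* Intersection of C with a supporting hyperplane, where u = 0 gives C itself. *)
Definition face F C : Prop :=
  exists u : 'cV[R]_n,
    (forall x, C x -> 0 <= (x *m u) 0 0) /\
    F = [set x | C x /\ (x *m u) 0 0 = 0]%classic.

Definition fan Sigma : Prop :=
  [/\ finite_set Sigma,
      (forall C, Sigma C -> rational_cone C),
      (forall C F, Sigma C -> face F C -> Sigma F)
    & (forall C D, Sigma C -> Sigma D ->
         face (C `&` D)%classic C /\ face (C `&` D)%classic D)].

Definition complete_fan Sigma : Prop :=
  (\bigcup_(C in Sigma) C = [set: 'rV[R]_n])%classic.

Definition regular_fan Sigma : Prop :=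
  forall C, Sigma C -> nonsingular_cone C.

(* The linear span of C is the line through x.                                 *)
Definition one_dimensional C : Prop :=
  exists x : 'rV[R]_n, [/\ x != 0, C x & forall y, C y -> exists a : R, y = a *: x].

Definition primitive v : Prop :=
  forall (d : int) w, v = d *: w -> `|d| = 1.

(* fset_set sends infinite sets to fset0; for a fan, the set is finite.        *)
Definition ray_generators Sigma : {fset 'rV[int]_n} :=
  fset_set [set v | primitive v /\
    exists C, [/\ Sigma C, one_dimensional C & C = cone [fset v]%fset]]%classic.

(* The i-th vertex is labelled by the generator v_i itself rather than by i.   *)
Definition underlying_complex Sigma : {set {set ray_generators Sigma}} :=
  [set A : {set ray_generators Sigma}
    | `[< Sigma (cone [fset val v | v in A]%fset) >]].

End Cones.

Section CanonicalFan.
Variable m : nat.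
Implicit Types (I J : {set 'I_m}) (K : {set {set 'I_m}}).

(* Indices start at 0: the last one, m.-1, gives the opposite of the sum.      *)
Definition evec (i : 'I_m) : 'rV[int]_(m.-1) :=
  if insub (val i) is Some j then delta_mx 0 j
  else - \sum_(j < m.-1) delta_mx 0 j.

Definition gens I J : {fset 'rV[int]_(m.-1)} :=
  ([fset - evec i | i in I] `|` [fset evec j | j in J])%fset.

Definition canonical_fan (R : realType) K : set (set 'rV[R]_(m.-1)) :=
  fun C => exists I J, [/\ I \in K, J \in alexander_dual K, [disjoint I & J]
                        & C = cone (gens I J)].

End CanonicalFan.

Arguments canonical_fan [m] R K.

(* Main.v *)
(* Every x in R^n, n = m - 1, is a combination a_1 e_1 + ... + a_m e_m, and a  *)
(* is unique up to adding a constant vector.  Moving the constant through the  *)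
(* values of a, exactly one shift satisfies {i | a_i < 0} \in K and            *)
(* {i | a_i <= 0} \notin K; call this representative balanced.  Since J' is    *)
(* in the dual of K iff the complement of J is not in K, the cone C(I, J) of   *)
(* the canonical fan consists of the points whose balanced representative is   *)
(* negative only on I and positive only on J.  Existence of the balanced       *)
(* representative gives completeness; its uniqueness shows that the cones meet *)
(* as the pairs (I, J) do, and that C(I, J) determines I and J.  Moreover      *)
(* I :|: J always misses some k, and the e_i with i != k are a basis of Z^n,   *)
(* which gives regularity, strong convexity and the supporting hyperplanes.    *)
Require Import Defs.
From mathcomp Require Import all_boot all_order all_algebra.
From mathcomp Require Import boolp classical_sets cardinality reals.
From mathcomp Require Import fintype finset finmap lra.

Set Implicit Arguments.
Unset Strict Implicit.
Unset Printing Implicit Defensive.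

Import Order.TTheory GRing.Theory Num.Theory.

(** The whole argument takes place upstairs, in the space of coefficient vectors [a], which maps
    onto R^n by [a *m evec_mx R n] with the constant vectors as kernel. There C(I, J) is the image
    of a cone cut out by sign conditions ([cone_gensP]). For I in K and J in the dual, the vectors
    of that sign cone are balanced ([subordinate_balanced]), and each point has exactly one balanced
    representative ([balanced_exists], [balanced_inj]). Hence intersections and inclusions of cones
    can be read off from signs ([cone_gensI], [cone_subordinate]).

    An index k outside I and J ([exists_free]) turns the quotient by constants into the
    normalisation a_k = 0. This yields a lattice basis, strong convexity and supporting functionals
    ([cone_gens_subface]); conversely every face arises by shrinking I and J ([face_cone_gens]).

    For the isomorphism, the rays are generated by the vectors -e_i and e_j labelled by the
    geometric vertices of Bier(K) ([fan_rayP]). Uniqueness of balanced representatives makes these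
    distinct and shows that a set of them spans a cone of the fan exactly when it is a face
    ([canonical_fan_bier]). *)

(** * Membership in the Alexander dual and in the Bier sphere *)

Lemma in_alexander_dual (T : finType) (K : {set {set T}}) (J : {set T}) :
  simplicial_complex K -> (J \in alexander_dual K) = (~: J \notin K).
Proof.
move=> [_ subK]; rewrite inE; apply/existsP/idP => [[I /andP[]] | JK].
  rewrite inE => /minsetP[/= IK _] JI; apply: contra IK => /subK; apply.
  by rewrite -setCS setCK.
(* Every non-face contains a minimal one; here the non-face is the complement of J. *)
have [I minI IJ] := minset_exists (P := [pred B | B \notin K]) JK.
by exists I; rewrite inE minI -setCS setCK.
Qed.

Lemma preimset_inl (T : finType) (I J : {set T}) :
  inl @^-1: (inl @: I :|: inr @: J) = I.
Proof.
apply/setP => i; rewrite !inE mem_imset; last by move=> ? ? [].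
by rewrite orbC; case: imsetP => // -[].
Qed.

Lemma preimset_inr (T : finType) (I J : {set T}) :
  inr @^-1: (inl @: I :|: inr @: J) = J.
Proof.
apply/setP => i; rewrite !inE mem_imset; last by move=> ? ? [].
by case: imsetP => // -[].
Qed.

Lemma in_bier (T : finType) (K : {set {set T}}) (A : {set (T + T)%type}) :
  (A \in bier K) =
    [&& inl @^-1: A \in K, inr @^-1: A \in alexander_dual K
      & [disjoint inl @^-1: A & inr @^-1: A]].
Proof.
have inl_inj : injective (@inl T T) by move=> ? ? [].
have inr_inj : injective (@inr T T) by move=> ? ? [].
apply/imset2P/and3P => [[I J IK] | [IK JK dIJ]].
  rewrite inE => /andP[JK dIJ] ->.
  by rewrite preimset_inl preimset_inr.
exists (inl @^-1: A) (inr @^-1: A) => //.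
  by move: JK; rewrite !inE => ->.
apply/setP => -[] i; rewrite !inE mem_imset // ?inE; last by case: imsetP => // -[].
by rewrite orbC; case: imsetP => // -[].
Qed.

(** * Coefficient vectors and the cones they parametrise *)

Section Representatives.
Local Open Scope ring_scope.

(** The rows are e_1, ..., e_m, the last one being constantly -1, so [a *m evec_mx R n] is the
    combination of the e_i with coefficients [a]. *)
Definition evec_mx (R : pzRingType) n : 'M[R]_(n.+1, n) :=
  \matrix_(i, j) ((i == lift ord_max j)%:R - (i == ord_max)%:R).

Lemma evecE n (i : 'I_n.+1) : evec i = row i (evec_mx int n).
Proof.
apply/rowP => j; rewrite !mxE /evec; case: insubP => [k lt_k def_k|].
  rewrite !mxE /= (_ : (i == ord_max) = false) ?subr0.
    congr (_ %:R); congr nat_of_bool; rewrite eq_sym -!val_eqE /= -def_k.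
    by rewrite /bump leqNgt ltn_ord add0n.
  by apply/negbTE; rewrite -val_eqE /= neq_ltn lt_k.
rewrite -leqNgt => le_n; have -> : i = ord_max.
  by apply/val_inj/eqP; rewrite eqn_leq le_n -ltnS ltn_ord.
rewrite (negbTE (neq_lift _ _)) eqxx sub0r mxE summxE (bigD1 j) //= big1 ?addr0.
  by rewrite mxE !eqxx.
by move=> k kj; rewrite mxE (eq_sym j) (negbTE kj) andbF.
Qed.

Lemma int_vec_evec (R : realType) n (i : 'I_n.+1) :
  int_vec R (evec i) = row i (evec_mx R n).
Proof. by rewrite evecE; apply/rowP => j; rewrite !mxE intrB !mulrz_nat. Qed.

Lemma mulmx_evec (R : pzRingType) n (a : 'rV[R]_n.+1) j :
  (a *m evec_mx R n) 0 j = a 0 (lift ord_max j) - a 0 ord_max.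
Proof.
rewrite mxE; under eq_bigr do rewrite mxE mulrBr.
rewrite sumrB; congr (_ - _).
  rewrite (bigD1 (lift ord_max j)) //= eqxx mulr1 big1 ?addr0 // => i /negbTE->.
  by rewrite mulr0.
by rewrite (bigD1 ord_max) //= eqxx mulr1 big1 ?addr0 // => i /negbTE->; rewrite mulr0.
Qed.

(** The only linear relation among the e_i is that their sum vanishes. *)
Lemma mulmx_evec_eq (R : pzRingType) n (a b : 'rV[R]_n.+1) :
  a *m evec_mx R n = b *m evec_mx R n -> a = b + const_mx (a 0 ord_max - b 0 ord_max).
Proof.
move=> ab; apply/rowP => i; rewrite !mxE.
case: (unliftP ord_max i) => [j|] ->; last by rewrite addrC subrK.
have /rowP/(_ j) := ab; rewrite !mulmx_evec => /eqP.
by rewrite subr_eq => /eqP->; rewrite -addrA (addrC (- _)).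
Qed.

Lemma mul_const_evec (R : pzRingType) n (t : R) :
  const_mx t *m evec_mx R n = 0 :> 'rV_n.
Proof. by apply/rowP => j; rewrite mulmx_evec !mxE subrr. Qed.

Lemma mulmx_evec_surj (R : pzRingType) n (x : 'rV[R]_n) :
  exists a, a *m evec_mx R n = x.
Proof.
exists (\row_i if unlift ord_max i is Some j then x 0 j else 0).
by apply/rowP => j; rewrite mulmx_evec !mxE liftK unlift_none subr0.
Qed.

Definition subordinate (R : numDomainType) n (I J : {set 'I_n}) (a : 'rV[R]_n) :=
  (forall i, a 0 i < 0 -> i \in I) /\ (forall i, 0 < a 0 i -> i \in J).

Lemma subordinateD (R : realDomainType) n (I J : {set 'I_n}) (a b : 'rV[R]_n) :
  subordinate I J a -> subordinate I J b -> subordinate I J (a + b).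
Proof.
move=> [aI aJ] [bI bJ]; split=> i; rewrite mxE => abi.
  have [/aI//|a_ge0] := ltP (a 0 i) 0; apply: bI; lra.
have [/aJ//|a_le0] := ltP 0 (a 0 i); apply: bJ; lra.
Qed.

Lemma subordinate_oppr_delta (R : realDomainType) n (I J : {set 'I_n}) i (c : R) :
  i \in I -> 0 <= c -> subordinate I J (- (c *: delta_mx 0 i)).
Proof.
move=> iI c0; split=> k; rewrite !mxE eqxx /=; case: eqP => [-> //|_].
- by rewrite mulr0 oppr0 ltxx.
- by rewrite mulr1 oppr_gt0 ltNge c0.
- by rewrite mulr0 oppr0 ltxx.
Qed.

Lemma subordinate_delta (R : realDomainType) n (I J : {set 'I_n}) j (c : R) :
  j \in J -> 0 <= c -> subordinate I J (c *: delta_mx 0 j).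
Proof.
move=> jJ c0; split=> k; rewrite !mxE eqxx /=; case: eqP => [-> //|_].
- by rewrite mulr1 ltNge c0.
- by rewrite mulr0 ltxx.
- by rewrite mulr0 ltxx.
Qed.

Section Cone.
Variables (R : realType) (n : nat).
Local Notation E := (evec_mx R n).

Lemma int_vecN (v : 'rV[int]_n) : int_vec R (- v) = - int_vec R v.
Proof. by apply/rowP => j; rewrite !mxE mulrNz. Qed.

Lemma coneD (S : {fset 'rV[int]_n}) (x y : 'rV[R]_n) :
  cone S x -> cone S y -> cone S (x + y).
Proof.
move=> [c [c0 ->]] [d [d0 ->]]; exists (fun v => c v + d v).
split=> [v|]; first by rewrite addr_ge0.
by rewrite -big_split; apply: eq_bigr => v _; rewrite scalerDl.
Qed.

Lemma cone0 (S : {fset 'rV[int]_n}) : cone S (0 : 'rV[R]_n).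
Proof. by exists (fun=> 0); split=> //; rewrite big1 // => v _; rewrite scale0r. Qed.

Lemma cone_gen (S : {fset 'rV[int]_n}) v (c : R) :
  v \in S -> 0 <= c -> cone S (c *: int_vec R v).
Proof.
move=> vS c0; exists (fun w => if w == v then c else 0).
split=> [w|]; first by case: ifP.
rewrite (bigD1_seq v) //= eqxx big1 ?addr0 // => w /negbTE->.
by rewrite scale0r.
Qed.

Lemma cone1 (v : 'rV[int]_n) (x : 'rV[R]_n) :
  cone [fset v]%fset x <-> exists2 c : R, 0 <= c & x = c *: int_vec R v.
Proof.
split=> [[c [c0 ->]]|[c c0 ->]]; last first.
  by apply: cone_gen => //; apply: fset11.
by exists (c v); rewrite ?big_seq_fset1.
Qed.

Lemma in_gens (I J : {set 'I_n.+1}) v :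
  v \in gens I J <->
    (exists2 i, i \in I & v = - evec i) \/ (exists2 j, j \in J & v = evec j).
Proof.
rewrite inE; split=> [/orP[]/imfsetP[i iI ->]|]; [by left; exists i|by right; exists i|].
by move=> [] [i iI ->]; apply/orP; [left|right]; apply/imfsetP; exists i.
Qed.

(** Both sides are closed under addition, so each inclusion is checked on a single term of a sum.
    This avoids matching coefficients with generators, which may coincide: -e_1 = e_2 when n = 1. *)
Lemma cone_gensP (I J : {set 'I_n.+1}) (x : 'rV[R]_n) :
  cone (gens I J) x <-> exists2 a, subordinate I J a & x = a *m E.
Proof.
split=> [[c [c0 ->]]|[a [aI aJ] ->]].
  rewrite big_seq; elim/big_ind: _.
  - by exists 0; [split=> i; rewrite mxE ltxx | rewrite mul0mx].
  - move=> _ _ [a sa ->] [b sb ->]; exists (a + b); last by rewrite mulmxDl.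
    exact: subordinateD.
  - move=> v /in_gens[] [i iI ->].
      exists (- (c (- evec i) *: delta_mx 0 i)); first exact: subordinate_oppr_delta.
      by rewrite mulNmx -scalemxAl -rowE int_vecN int_vec_evec scalerN.
    exists (c (evec i) *: delta_mx 0 i); first exact: subordinate_delta.
    by rewrite -scalemxAl -rowE int_vec_evec.
rewrite mulmx_sum_row; elim/big_ind: _ => [||i _]; [exact: cone0|exact: coneD|].
rewrite -int_vec_evec; case: (ltgtP (a 0 i) 0) => [ai|ai|->].
- rewrite -[a 0 i]opprK scaleNr -scalerN -int_vecN; apply: cone_gen; last lra.
  by apply/in_gens; left; exists i => //; apply: aI.
- apply: cone_gen; last exact: ltW.
  by apply/in_gens; right; exists i => //; apply: aJ.
- by rewrite scale0r; apply: cone0.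
Qed.

End Cone.

End Representatives.

(** * Balanced representatives: existence, uniqueness, intersections of cones *)

Section Balanced.
Local Open Scope ring_scope.
Variables (R : realType) (n : nat) (K : {set {set 'I_n.+1}}).
Hypotheses (cK : simplicial_complex K) (fullK : setT \notin K).
Implicit Types (I J : {set 'I_n.+1}) (a b : 'rV[R]_n.+1).
Local Notation E := (evec_mx R n).

Definition balanced a :=
  [set i | a 0 i < 0] \in K /\ [set i | a 0 i <= 0] \notin K.

(** The negative set of [a] lies in the face I, and its non-positive set contains the complement of
    J, a non-face. *)
Lemma subordinate_balanced I J a :
  I \in K -> J \in alexander_dual K -> subordinate I J a -> balanced a.
Proof.
have subK := cK.2; rewrite in_alexander_dual // => IK JK [aI aJ]; split.
  by apply: subK IK _; apply/subsetP => i; rewrite inE; apply: aI.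
apply: contra JK => /subK; apply; apply/subsetP => i; rewrite !inE.
by apply: contraR; rewrite -ltNge; apply: aJ.
Qed.

Lemma balanced_exists (x : 'rV[R]_n) : exists2 a, balanced a & x = a *m E.
Proof.
have subK := cK.2; have [a <-] := mulmx_evec_surj x.
pose below i := [set j | a 0 j <= a 0 i].
have [i0 _ max_i0] := arg_maxP (P := predT) (fun i => a 0 i) (erefl true : predT ord_max).
have i0K : below i0 \notin K.
  suff -> : below i0 = setT by [].
  by apply/setP => j; rewrite !inE; apply: max_i0.
(* The shift is the least value of [a] whose closed sublevel set is a non-face; the maximum of [a]
   is a candidate since the full set is a non-face. *)
have [i iK min_i] := arg_minP (P := fun i => below i \notin K) (fun i => a 0 i) i0K.
exists (a - const_mx (a 0 i)); last by rewrite mulmxBl mul_const_evec subr0.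
split; last first.
  by move: iK; congr (_ \notin K); apply/setP => j; rewrite !inE !mxE subr_le0.
have -> : [set j | (a - const_mx (a 0 i)) 0 j < 0] = [set j | a 0 j < a 0 i].
  by apply/setP => j; rewrite !inE !mxE subr_lt0.
have [->|[j0]] := set_0Vmem [set j | a 0 j < a 0 i].
  have /set0Pn[A AK] := cK.1; exact: subK AK (sub0set A).
rewrite inE => j0i.
(* The strict sublevel set at [a 0 i] lies in the closed one at the next smaller value, which is a
   face by minimality. *)
have [j ji max_j] := arg_maxP (P := fun j => a 0 j < a 0 i) (fun i => a 0 i) j0i.
have : below j \in K by apply: contraLR ji => /min_i; rewrite -leNgt.
by move/subK; apply; apply/subsetP => k; rewrite !inE; apply: max_j.
Qed.

(** If t were positive, the non-positive set of [a] would lie in the negative set of [b], which is a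
    face. *)
Lemma balanced_shift_le0 a b t : balanced a -> balanced b -> a = b + const_mx t -> t <= 0.
Proof.
move=> [_ a0K] [bK _] def_a; rewrite leNgt; apply: contra a0K => t_gt0.
apply: (cK.2 _ _ bK); apply/subsetP => i; rewrite !inE def_a !mxE; lra.
Qed.

Lemma balanced_inj a b : balanced a -> balanced b -> a *m E = b *m E -> a = b.
Proof.
move=> Ba Bb ab; have a_def := mulmx_evec_eq ab; have b_def := mulmx_evec_eq (esym ab).
have := balanced_shift_le0 Ba Bb a_def; have := balanced_shift_le0 Bb Ba b_def.
move=> t1 t2; rewrite a_def (_ : _ - _ = 0); last lra.
by rewrite (_ : const_mx 0 = 0) ?addr0 //; apply/rowP => i; rewrite !mxE.
Qed.

(** The representative witnessing membership in the cone is itself balanced, hence equal to [a]. *)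
Lemma cone_subordinate I J a :
  I \in K -> J \in alexander_dual K -> balanced a ->
  cone (gens I J) (a *m E) -> subordinate I J a.
Proof.
move=> IK JK Ba /cone_gensP[b sb ab].
by rewrite (balanced_inj Ba _ ab) //; apply: subordinate_balanced sb.
Qed.

Lemma cone_gensI I J I' J' :
  I \in K -> J \in alexander_dual K -> I' \in K -> J' \in alexander_dual K ->
  (cone (gens I J) `&` cone (gens I' J') =
     cone (gens (I :&: I') (J :&: J')) :> set 'rV[R]_n)%classic.
Proof.
move=> IK JK I'K J'K; apply/seteqP; split=> x.
  move=> [/cone_gensP[a sa ->] ca']; apply/cone_gensP; exists a => //.
  have [aI' aJ'] := cone_subordinate I'K J'K (subordinate_balanced IK JK sa) ca'.
  by case: sa => aI aJ; split=> i ai; rewrite inE; [rewrite aI ?aI'|rewrite aJ ?aJ'].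
move=> /cone_gensP[a [aI aJ] ->].
by split; apply/cone_gensP; exists a => //; split=> i ai;
  [have := aI i ai|have := aJ i ai|have := aI i ai|have := aJ i ai];
  rewrite inE => /andP[].
Qed.

(** * Faces, strong convexity and regularity of a single cone *)

(** Such a k selects one representative on each class modulo constants: subordinate vectors vanish
    at k. *)
Lemma exists_free I J :
  I \in K -> J \in alexander_dual K -> exists2 k, k \notin I & k \notin J.
Proof.
rewrite in_alexander_dual // => IK JK.
have /subsetPn[k] : ~~ (~: J \subset I) by apply: contra JK; apply: cK.2.
by rewrite inE; exists k.
Qed.

Lemma subordinate_free I J a k :
  k \notin I -> k \notin J -> subordinate I J a -> a 0 k = 0.
Proof.
move=> kI kJ [aI aJ]; case: (ltgtP (a 0 k) 0) => // ak.
  by rewrite aI in kI.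
by rewrite aJ in kJ.
Qed.

(** A functional upstairs descends to R^n once it kills the constant vectors. *)
Lemma evec_mx_col_surj (w : 'cV[R]_n.+1) : \sum_i w i 0 = 0 -> exists u, E *m u = w.
Proof.
rewrite (bigD1_ord ord_max) //= => sum_w; exists (\col_j w (lift ord_max j) 0).
apply/colP => i; rewrite mxE; under eq_bigr do rewrite !mxE mulrBl.
rewrite sumrB -mulr_sumr; case: (unliftP ord_max i) => [j|] ->.
  rewrite [X in _ - X * _](_ : _ = 0) ?mul0r ?subr0; last first.
    by rewrite eq_sym (negbTE (neq_lift _ _)).
  rewrite (bigD1 j) //= eqxx mul1r big1 ?addr0 // => k kj.
  by rewrite (inj_eq lift_inj) eq_sym (negbTE kj) mul0r.
rewrite eqxx mul1r big1 ?sub0r => [|j _]; last by rewrite (negbTE (neq_lift _ _)) mul0r.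
by apply/eqP; rewrite eq_sym -addr_eq0 sum_w.
Qed.

Lemma cone_gens_subface I J I' J' :
  I \in K -> J \in alexander_dual K -> [disjoint I & J] -> I' \subset I -> J' \subset J ->
  face (cone (gens I' J')) (cone (gens I J) : set 'rV[R]_n).
Proof.
move=> IK JK dIJ sI sJ; have [k kI kJ] := exists_free IK JK.
have dij i : ~~ ((i \in I) && (i \in J)).
  by apply/negP => /andP[iI]; rewrite (disjointFr dIJ iI).
(* The weights are positive on the e_j and on the -e_i to be removed, and zero on the generators
   that stay. Correcting at k makes the total zero, so the functional descends; its values on the
   cone do not change because [a 0 k = 0] there. *)
pose w0 i : R := (i \in J :\: J')%:R - (i \in I :\: I')%:R.
pose w := \col_i (w0 i - (\sum_j w0 j) * (i == k)%:R) : 'cV[R]_n.+1.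
have [u wE] : exists u, E *m u = w.
  apply: evec_mx_col_surj; under eq_bigr do rewrite mxE.
  have delta1 : \sum_i (i == k)%:R = 1 :> R.
    by rewrite (bigD1 k) //= eqxx big1 ?addr0 // => i /negbTE->.
  by rewrite sumrB -mulr_sumr delta1 mulr1 subrr.
have eval a : subordinate I J a -> (a *m E *m u) 0 0 = \sum_i a 0 i * w0 i.
  move=> sa; rewrite -mulmxA wE mxE; apply: eq_bigr => i _; rewrite mxE mulrBr.
  case: (eqVneq i k) => [->|_]; last by rewrite !mulr0 subr0.
  by rewrite (subordinate_free kI kJ sa) !mul0r subr0.
have pos a i : subordinate I J a -> 0 <= a 0 i * w0 i.
  move=> [aI aJ]; rewrite /w0 !inE.
  case: (ltgtP (a 0 i) 0) => ai; last by rewrite ai mul0r.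
    move: (aI _ ai) (dij i) => -> /= /negbTE->.
    by case: (i \in I'); rewrite /= ?andbF ?subrr ?mulr0 // sub0r mulrN1; lra.
  move: (aJ _ ai) (dij i) => ->; rewrite andbT => /negbTE->.
  by rewrite andbF subr0 mulr_ge0 // ltW.
exists u; split=> [x /cone_gensP[a sa ->]|].
  by rewrite eval ?sumr_ge0 // => i _; apply: pos.
apply/seteqP; split=> x.
  move=> /cone_gensP[a sa' ->]; have sa : subordinate I J a.
    by case: sa' => aI aJ; split=> i ai; [apply/(subsetP sI)/aI|apply/(subsetP sJ)/aJ].
  split; first by apply/cone_gensP; exists a.
  rewrite eval // big1 // => i _; rewrite /w0 !inE; case: sa' => aI aJ.
  case: (ltgtP (a 0 i) 0) => ai; last by rewrite ai mul0r.
    have iI' := aI _ ai; move: (dij i); rewrite (subsetP sI) // iI' /= => /negbTE->.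
    by rewrite andbF subrr mulr0.
  have iJ' := aJ _ ai; move: (dij i); rewrite (subsetP sJ) // iJ' andbT => /negbTE->.
  by rewrite andbF subrr mulr0.
move=> [/cone_gensP[a sa ->]]; rewrite eval // => /psumr_eq0P a0.
apply/cone_gensP; exists a => //.
have {}a0 i : a 0 i * w0 i = 0 by apply: a0 => // j _; apply: pos.
case: (sa) => aI aJ.
split=> i ai.
  have iI := aI _ ai; apply: contraT => iI'; have := dij i; rewrite iI /= => /negbTE iJ.
  have := a0 i; rewrite /w0 !inE iI iI' iJ andbF sub0r mulrN1; lra.
have iJ := aJ _ ai; apply: contraT => iJ'; have := dij i; rewrite iJ andbT => /negbTE iI.
have := a0 i; rewrite /w0 !inE iJ iJ' iI andbF subr0 mulr1; lra.
Qed.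

(** The supporting functional is non-negative on each generator, so its value is a sum of
    non-negative terms. It vanishes only when every term does, and the face is spanned by the
    generators it kills. *)
Lemma face_cone_gens I J F :
  face F (cone (gens I J) : set 'rV[R]_n) ->
  exists I' J', [/\ I' \subset I, J' \subset J & F = cone (gens I' J')].
Proof.
move=> [u [u_ge0 ->]]; pose h i := (E *m u) i 0.
have eval a : (a *m E *m u) 0 0 = \sum_i a 0 i * h i by rewrite -mulmxA mxE.
have evald i : ((delta_mx 0 i : 'rV_n.+1) *m E *m u) 0 0 = h i.
  by rewrite -mulmxA -rowE mxE.
have hI i : i \in I -> h i <= 0.
  move=> iI; have : 0 <= (- (delta_mx 0 i : 'rV_n.+1) *m E *m u) 0 0; last first.
    by rewrite !mulNmx mxE evald oppr_ge0.
  apply: u_ge0.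
  apply/cone_gensP; eexists; last by [].
  by rewrite -[delta_mx _ _]scale1r; apply: subordinate_oppr_delta.
have hJ i : i \in J -> 0 <= h i.
  move=> iJ; rewrite -evald; apply: u_ge0.
  apply/cone_gensP; eexists; last by [].
  by rewrite -[delta_mx _ _]scale1r; apply: subordinate_delta.
have pos a i : subordinate I J a -> 0 <= a 0 i * h i.
  move=> [aI aJ]; case: (ltgtP (a 0 i) 0) => ai; last by rewrite ai mul0r.
    by rewrite mulr_le0 ?hI ?aI // ltW.
  by rewrite mulr_ge0 ?hJ ?aJ // ltW.
exists [set i in I | h i == 0], [set i in J | h i == 0].
split; try by apply/subsetP => i; rewrite inE => /andP[].
apply/seteqP; split=> x.
  move=> [/cone_gensP[a sa ->]]; rewrite eval => /psumr_eq0P a0.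
  apply/cone_gensP; exists a => //.
  have {}a0 i : a 0 i * h i = 0 by apply: a0 => // j _; apply: pos.
  case: sa => aI aJ; split=> i ai; rewrite inE; [rewrite aI|rewrite aJ] => //=;
    have /eqP := a0 i; rewrite mulf_eq0 => /orP[/eqP|//];
    by move: ai => /[swap] ->; rewrite ltxx.
move=> /cone_gensP[a [aI aJ] ->]; split.
  apply/cone_gensP; exists a => //.
  by split=> i; [move/aI|move/aJ]; rewrite inE => /andP[].
rewrite eval big1 // => i _; case: (ltgtP (a 0 i) 0) => ai; last by rewrite ai mul0r.
  by have := aI _ ai; rewrite inE => /andP[_ /eqP->]; rewrite mulr0.
by have := aJ _ ai; rewrite inE => /andP[_ /eqP->]; rewrite mulr0.
Qed.

Lemma cone_gens_strongly_convex I J :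
  I \in K -> J \in alexander_dual K -> [disjoint I & J] ->
  strongly_convex (cone (gens I J) : set 'rV[R]_n).
Proof.
move=> IK JK dIJ [x [y [/negP y0 line]]]; apply: y0.
have [k kI kJ] := exists_free IK JK.
have [a ax] := mulmx_evec_surj x; have [b by_] := mulmx_evec_surj y.
suff bk i : b 0 i = b 0 k.
  rewrite -by_; apply/eqP/rowP => j; rewrite mulmx_evec mxE bk.
  by rewrite [b 0 ord_max]bk subrr.
apply/eqP; apply: contraT => bi.
pose d := b 0 i - b 0 k; have d0 : d != 0 by rewrite subr_eq0.
(* The representative of x + s y vanishing at k has an i-th coordinate that is affine in s with
   slope d. As d is nonzero, s can be solved for the values -1 and 1, which puts i in both I and
   J. *)
have at_ s : exists2 c, subordinate I J c & c 0 i = a 0 i - a 0 k + s * d.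
  have /cone_gensP[c sc] := line s.
  rewrite -ax -by_ scalemxAl -mulmxDl => /mulmx_evec_eq def_c.
  exists c => //; have ck := subordinate_free kI kJ sc.
  move/rowP: def_c => def_c; have := def_c i; have := def_c k; rewrite !mxE ck /d; lra.
have [c [cI _] ci] := at_ ((- 1 - (a 0 i - a 0 k)) / d).
have [e [_ eJ] ei] := at_ ((1 - (a 0 i - a 0 k)) / d).
have iI : i \in I by apply: cI; rewrite ci divfK //; lra.
have iJ : i \in J by apply: eJ; rewrite ei divfK //; lra.
by have := disjointFr dIJ iI; rewrite iJ.
Qed.

(** The basis consists of the e_i with i != k, with sign reversed for i in I; [spread] gives the
    coefficient vector that is zero at k. *)
Lemma cone_gens_nonsingular I J :
  I \in K -> J \in alexander_dual K -> [disjoint I & J] ->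
  nonsingular_cone (cone (gens I J) : set 'rV[R]_n).
Proof.
move=> IK JK dIJ; have [k kI kJ] := exists_free IK JK.
pose s (i : 'I_n) : int := if lift k i \in I then -1 else 1.
have ss i : s i * s i = 1 by rewrite /s; case: ifP.
pose spread (c : 'rV[int]_n) : 'rV[int]_n.+1 :=
  \row_i if unlift k i is Some j then c 0 j * s j else 0.
have spreadE (c : 'rV_n) :
    \sum_i c 0 i *: (s i *: evec (lift k i)) = spread c *m evec_mx int n.
  rewrite mulmx_sum_row (bigD1_ord k) //= mxE unlift_none scale0r add0r.
  by apply: eq_bigr => i _; rewrite scalerA mxE liftK evecE.
exists (gens I J), (fun i => s i *: evec (lift k i)); split=> //.
  move=> v; have [p <-] := mulmx_evec_surj v.
  exists (\row_i ((p 0 (lift k i) - p 0 k) * s i)); split.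
    rewrite spreadE -[LHS]subr0 -(mul_const_evec n (p 0 k)) -mulmxBl; congr (_ *m _).
    apply/rowP => i; rewrite !mxE; case: (unliftP k i) => [j|] ->; last by rewrite subrr.
    by rewrite !mxE -mulrA ss mulr1.
  move=> c; rewrite spreadE => /mulmx_evec_eq/rowP pc; apply/rowP => i.
  have := pc (lift k i); have := pc k; rewrite !mxE unlift_none liftK add0r => -> ->.
  by rewrite addrK -mulrA ss mulr1.
move=> v /in_gens[] [i iI ->].
  case: (unliftP k i) iI => [j|] -> iI; last by rewrite iI in kI.
  by exists j; rewrite /s iI scaleN1r.
case: (unliftP k i) iI => [j|] -> iI; last by rewrite iI in kJ.
by exists j; rewrite /s (disjointFl dIJ iI) scale1r.
Qed.

End Balanced.

Lemma alexander_dual_sub (T : finType) (K : {set {set T}}) (A B : {set T}) :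
  A \in alexander_dual K -> B \subset A -> B \in alexander_dual K.
Proof.
rewrite !inE => /existsP[I /andP[IK AI]] BA.
by apply/existsP; exists I; rewrite IK (subset_trans BA).
Qed.

Lemma bier_sub (T : finType) (K : {set {set T}}) (A B : {set (T + T)%type}) :
  simplicial_complex K -> A \in bier K -> B \subset A -> B \in bier K.
Proof.
move=> [_ subK]; rewrite !in_bier => /and3P[IK JK dIJ] BA; apply/and3P; split.
- exact: subK IK (preimsetS _ BA).
- exact: alexander_dual_sub JK (preimsetS _ BA).
- by apply: disjointWl (preimsetS _ BA) _; apply: disjointWr (preimsetS _ BA) _.
Qed.

(** * The canonical fan is a complete regular fan *)

Section CanonicalFan.
Local Open Scope ring_scope.
Variables (R : realType) (n : nat) (K : {set {set 'I_n.+1}}).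
Hypotheses (cK : simplicial_complex K) (fullK : setT \notin K).
Local Notation E := (evec_mx R n).
Local Notation Sigma := (canonical_fan R K).

Lemma canonical_fan_fan : fan Sigma.
Proof.
have subK := cK.2; split.
- apply: (@sub_finite_set _ _
    ((fun IJ : {set 'I_n.+1} * {set 'I_n.+1} => cone (gens IJ.1 IJ.2))
      @` [set: _])%classic).
    by move=> _ [I [J [_ _ _ ->]]]; exists (I, J).
  by apply: finite_image; apply: finite_finset.
- move=> _ [I [J [IK JK dIJ ->]]]; split; first by exists (gens I J).
  exact: cone_gens_strongly_convex JK dIJ.
- move=> _ F [I [J [IK JK dIJ ->]]] /face_cone_gens[I' [J' [sI sJ ->]]].
  exists I', J'; split=> //; first exact: subK IK sI.
    exact: alexander_dual_sub JK sJ.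
  by apply: disjointWl sI _; apply: disjointWr sJ _.
- move=> _ _ [I [J [IK JK dIJ ->]]] [I' [J' [I'K J'K dIJ' ->]]].
  rewrite (cone_gensI R cK) //.
  by split; apply: (@cone_gens_subface _ _ K); rewrite ?subsetIl ?subsetIr.
Qed.

Lemma canonical_fan_complete : complete_fan Sigma.
Proof.
apply/seteqP; split=> // x _; have [a [aK a0K] ->] := balanced_exists cK fullK x.
(* The signs of the balanced representative select a cone containing x. *)
pose I := [set i | a 0 i < 0]; pose J := [set i | 0 < a 0 i].
exists (cone (gens I J)); last first.
  by apply/cone_gensP; exists a => //; split=> i; rewrite inE.
exists I, J; split=> //.
  rewrite in_alexander_dual //; move: a0K; congr (_ \notin K).
  by apply/setP => i; rewrite !inE leNgt.
by apply/pred0P => i; rewrite /= !inE; case: ltgtP.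
Qed.

Lemma canonical_fan_regular : regular_fan Sigma.
Proof.
by move=> _ [I [J [IK JK dIJ ->]]]; apply: (cone_gens_nonsingular R cK).
Qed.

(** * Rays of the fan and vertices of the Bier sphere *)

Definition ray_vec (z : 'I_n.+1 + 'I_n.+1) : 'rV[int]_n :=
  match z with inl i => - evec i | inr j => evec j end.

Definition ray_coords (z : 'I_n.+1 + 'I_n.+1) : 'rV[R]_n.+1 :=
  match z with inl i => - delta_mx 0 i | inr j => delta_mx 0 j end.

Lemma mul_ray_coords z : ray_coords z *m E = int_vec R (ray_vec z).
Proof. by case: z => i /=; rewrite ?mulNmx -rowE ?int_vecN int_vec_evec. Qed.

Lemma gens_ray_vec (A : {set 'I_n.+1 + 'I_n.+1}) :
  [fset ray_vec z | z in A]%fset = gens (inl @^-1: A) (inr @^-1: A).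
Proof.
apply/fsetP => v; apply/imfsetP/idP => [[[i|i] /= iA ->]|].
- by apply/in_gens; left; exists i; rewrite ?inE.
- by apply/in_gens; right; exists i; rewrite ?inE.
move=> /in_gens[] [i]; rewrite inE => iA ->; first by exists (inl i).
by exists (inr i).
Qed.

Lemma subordinate_ray_coords (A : {set 'I_n.+1 + 'I_n.+1}) z :
  subordinate (inl @^-1: A) (inr @^-1: A) (ray_coords z) <-> z \in A.
Proof.
split.
  move: z => [] i [/(_ i) + /(_ i)]; rewrite !inE /= !mxE !eqxx /=.
    by rewrite oppr_lt0 ltr01 => ->.
  by rewrite ltr01 => _ ->.
case: z => i iA /=; rewrite -[delta_mx _ _]scale1r.
  by apply: subordinate_oppr_delta; rewrite ?inE.
by apply: subordinate_delta; rewrite ?inE.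
Qed.

Lemma ray_coords_balanced z : z \in geom_vertices (bier K) -> balanced K (ray_coords z).
Proof.
rewrite inE in_bier => /and3P[IK JK _].
by apply: (subordinate_balanced cK IK JK); apply/subordinate_ray_coords; rewrite inE.
Qed.

Lemma ray_vec_cone (A : {set 'I_n.+1 + 'I_n.+1}) z : z \in A ->
  cone (gens (inl @^-1: A) (inr @^-1: A)) (int_vec R (ray_vec z)).
Proof.
move=> zA; rewrite -mul_ray_coords; apply/cone_gensP; exists (ray_coords z) => //.
exact/subordinate_ray_coords.
Qed.

(** The cone might come from another pair (I, J). Since [ray_coords z] is balanced for a geometric
    vertex z, uniqueness forces the index of each generator into that I or J. The vector of a ghost
    vertex can coincide with that of a geometric one, whence the restriction on A. *)
Lemma canonical_fan_bier (A : {set 'I_n.+1 + 'I_n.+1}) :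
  A \subset geom_vertices (bier K) ->
  Sigma (cone [fset ray_vec z | z in A]%fset) <-> A \in bier K.
Proof.
move=> sA; rewrite gens_ray_vec in_bier; split=> [|/and3P[IK JK dIJ]]; last first.
  by exists (inl @^-1: A), (inr @^-1: A).
move=> [I [J [IK JK dIJ eqC]]].
have sub z : z \in A -> subordinate I J (ray_coords z).
  move=> zA; apply: (cone_subordinate cK IK JK).
    exact/ray_coords_balanced/(subsetP sA).
  by rewrite mul_ray_coords -eqC; apply: ray_vec_cone.
have sI : inl @^-1: A \subset I.
  apply/subsetP => i; rewrite inE => /sub[/(_ i) + _]; rewrite /= !mxE !eqxx /=.
  by rewrite oppr_lt0 ltr01; apply.
have sJ : inr @^-1: A \subset J.
  apply/subsetP => i; rewrite inE => /sub[_ /(_ i)]; rewrite /= !mxE !eqxx /=.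
  by rewrite ltr01; apply.
rewrite (cK.2 _ _ IK sI) (alexander_dual_sub JK sJ) /=.
by apply: disjointWl sI _; apply: disjointWr sJ _.
Qed.

Lemma ray_vec_inj : {in geom_vertices (bier K) &, injective ray_vec}.
Proof.
move=> z z' zV z'V eq_zz'; have /subordinate_ray_coords := set11 z.
rewrite (balanced_inj cK (ray_coords_balanced zV) (ray_coords_balanced z'V)).
  by move/subordinate_ray_coords; rewrite inE => /eqP.
by rewrite !mul_ray_coords eq_zz'.
Qed.

Hypothesis n_gt0 : (0 < n)%N.

Lemma ray_vec_unit_entry z : exists j, `|ray_vec z 0 j| = 1.
Proof.
have entry (i : 'I_n.+1) : exists j, `|evec i 0 j| = 1.
  rewrite evecE; case: (unliftP ord_max i) => [j|] ->.
    by exists j; rewrite !mxE eqxx eq_sym (negbTE (neq_lift _ _)).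
  by exists (Ordinal n_gt0); rewrite !mxE eqxx (negbTE (neq_lift _ _)).
by case: z => i; have [j ij] := entry i; exists j; rewrite //= mxE normrN.
Qed.

Lemma ray_vec_primitive z : primitive (ray_vec z).
Proof.
move=> d w zdw; have [j] := ray_vec_unit_entry z; rewrite zdw mxE normrM -!abszE.
by move=> [/eqP]; rewrite muln_eq1 => /andP[/eqP-> _].
Qed.

Lemma int_vec_ray_neq0 z : int_vec R (ray_vec z) != 0.
Proof.
have [j] := ray_vec_unit_entry z.
apply: contra_eq_neq => /rowP/(_ j)/eqP; rewrite !mxE intr_eq0 => /eqP->.
by rewrite normr0.
Qed.

Lemma cone_ray_eq z v (c : R) :
  primitive v -> 0 <= c -> int_vec R (ray_vec z) = c *: int_vec R v -> v = ray_vec z.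
Proof.
move=> prim_v c_ge0 zcv; have [j zj] := ray_vec_unit_entry z.
(* As g is 1 or -1, comparing j-th entries gives c d = 1. Hence v is the integer multiple d of
   [ray_vec z]; primitivity of v gives |d| = 1 and c >= 0 gives the sign. *)
set g := ray_vec z 0 j in zj; pose d := g * v 0 j.
have gg : g * g = 1 by rewrite -expr2 -real_normK ?num_real // zj expr1n.
have zE l : (ray_vec z 0 l)%:~R = c * (v 0 l)%:~R.
  by have /rowP/(_ l) := zcv; rewrite !mxE.
have cd : c * d%:~R = 1 by rewrite intrM mulrCA -zE -intrM gg.
have vdz : v = d *: ray_vec z.
  apply/rowP => l; apply: (@intr_inj R); rewrite mxE intrM zE mulrA.
  by rewrite [_ * c]mulrC cd mul1r.
have d1 : `|d| = 1 := prim_v _ _ vdz.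
have d_gt0 : 0 < d.
  rewrite -(ltr0z R); have : 0 < c * d%:~R by rewrite cd.
  rewrite pmulr_rgt0 // lt_def c_ge0 andbT; apply: contra_eq_neq cd => ->.
  by rewrite mul0r eq_sym oner_eq0.
by rewrite vdz -(gtr0_norm d_gt0) d1 scale1r.
Qed.

Lemma fan_rayP v :
  (primitive v /\ exists C, [/\ Sigma C, one_dimensional C & C = cone [fset v]%fset]) <->
  exists2 z, z \in geom_vertices (bier K) & v = ray_vec z.
Proof.
split=> [[prim_v [_ [[I [J [IK JK dIJ ->]]] [x [x0 Cx _]] Cv]]]|[z zV ->]].
  pose A := (inl @: I :|: inr @: J : {set 'I_n.+1 + 'I_n.+1}).
  have AK : A \in bier K.
    by apply/imset2P; exists I J; rewrite ?inE // dIJ andbT; rewrite inE in JK.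
  (* A cone with a nonzero point has a generator, and any generator lies on the ray of v. *)
  have [z zA] : exists z, z \in A.
    move/cone_gensP: Cx x0 => [a sa ->] aE0.
    case: (set_0Vmem A) => [A0|[z zA]]; last by exists z.
    case/eqP: aE0; rewrite (_ : a = 0) ?mul0mx //; apply/rowP => i.
    have iI : i \notin I.
      by apply/negP => iI; have : inl i \in A; [rewrite inE imset_f | rewrite A0 inE].
    have iJ : i \notin J.
      by apply/negP => iJ; have : inr i \in A; [rewrite inE orbC imset_f | rewrite A0 inE].
    by rewrite mxE (subordinate_free iI iJ sa).
  exists z; first by rewrite inE; apply: bier_sub AK _ => //; rewrite sub1set.
  have := ray_vec_cone zA; rewrite preimset_inl preimset_inr Cv => /cone1[c c0].
  exact: cone_ray_eq.
split; first exact: ray_vec_primitive.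
exists (cone [fset ray_vec z]%fset); split=> //; last first.
  exists (int_vec R (ray_vec z)); split; first exact: int_vec_ray_neq0.
    by apply/cone1; exists 1; rewrite ?scale1r ?ler01.
  by move=> y /cone1[c _ ->]; exists c.
have -> : [fset ray_vec z]%fset = [fset ray_vec z' | z' in [set z]]%fset.
  apply/fsetP => v'; rewrite inE; apply/eqP/imfsetP => [->|[z' /=]].
    by exists z; rewrite //= inE.
  by rewrite inE => /eqP->.
apply/canonical_fan_bier; first by rewrite sub1set.
by rewrite inE in zV.
Qed.

Lemma in_ray_generators v :
  v \in ray_generators Sigma <-> exists2 z, z \in geom_vertices (bier K) & v = ray_vec z.
Proof.
rewrite in_fset_set; first by rewrite -fan_rayP; split=> [/set_mem|/mem_set].
apply: (@sub_finite_set _ _ (ray_vec @` [set: _])%classic).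
  by move=> w /fan_rayP[z _ ->]; exists z.
by apply: finite_image; apply: finite_finset.
Qed.

Lemma bier_iso_underlying_complex : complex_iso (bier K) (underlying_complex Sigma).
Proof.
set V := geom_vertices (bier K); set L := underlying_complex Sigma.
(* Each generator spans a cone of the fan, so the underlying complex has no ghost vertices. *)
have geomL (v : ray_generators Sigma) : v \in geom_vertices L.
  rewrite !inE; apply/asboolP; have /in_ray_generators[z zV vz] := valP v.
  have -> : [fset val u | u in [set v]]%fset = [fset ray_vec z' | z' in [set z]]%fset.
    apply/fsetP => w; apply/imfsetP/imfsetP => /= -[u]; rewrite inE => /eqP-> ->.
      by exists z; rewrite ?inE.
    by exists v; rewrite ?inE.
  apply/canonical_fan_bier; first by rewrite sub1set.
  by rewrite inE in zV.
have /choice[f fE] : forall x : {x | x \in V},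
    exists y : {y | y \in geom_vertices L}, val (val y) = ray_vec (val x).
  move=> x.
  have xr : ray_vec (val x) \in ray_generators Sigma.
    by apply/in_ray_generators; exists (val x) => //; apply: (valP x).
  by exists (Sub (FSetSub xr) (geomL _)).
have f_inj : injective f.
  move=> x y fxy; apply/val_inj/ray_vec_inj; [exact: (valP x)|exact: (valP y)|].
  by rewrite -!fE fxy.
have /choice[g fg] : forall y, exists x, f x = y.
  move=> y; have /in_ray_generators[z zV yz] := valP (val y).
  by exists (Sub z zV); do 2!apply: val_inj; rewrite fE /= yz.
exists f; split=> [|A]; first by exists g => // x; apply: f_inj; rewrite fg.
rewrite [RHS]inE; have -> : [fset val v | v in val @: (f @: A)]%fset =
    [fset ray_vec z | z in val @: A]%fset.
  apply/fsetP => w; apply/imfsetP/imfsetP => /= -[].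
    move=> _ /imsetP[_ /imsetP[x xA ->] ->] ->; exists (val x); last exact: fE.
    exact: imset_f.
  move=> _ /imsetP[x xA ->] ->; exists (val (f x)); last by rewrite fE.
  by rewrite !imset_f.
have AV : val @: A \subset V by apply/subsetP => _ /imsetP[x _ ->]; apply: (valP x).
by apply/idP/asboolP => /(canonical_fan_bier AV).
Qed.

End CanonicalFan.

Theorem theorem3p3 (R : realType) (m : nat) (K : {set {set 'I_m}})
    (m_ge2 : 2 <= m) (cK : simplicial_complex K)
    (K_neq : K <> powerset [set: 'I_m]) :
  [/\ fan (canonical_fan R K),
      complete_fan (canonical_fan R K)
    & regular_fan (canonical_fan R K)] /\
  complex_iso (bier K) (underlying_complex (canonical_fan R K)).
Proof.
have fullK : setT \notin K.
  apply/negP => TK; apply: K_neq; apply/setP => A; rewrite inE subsetT.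
  by apply: cK.2 TK _; apply: subsetT.
(* Writing m as n + 1 makes [m.-1] compute to n and turns the bound on m into 0 < n. *)
case: m K m_ge2 cK fullK {K_neq} => // n K n_gt0 cK fullK; split; first split.
- exact: canonical_fan_fan.
- exact: canonical_fan_complete.
- exact: canonical_fan_regular.
- exact: bier_iso_underlying_complex.
Qed.
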